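(* Let $n\geq 3$ be an integer. Then $$t(n,3,5)\leq 2n-2.$$
   Context: All graphs are finite, undirected and simple. Let $G$ be a nontrivial connected graph of order $n$ (i.e. with $n$ vertices). An edge-coloring of $G$ is any assignment of colors to the edges (adjacent edges may receive the same color). A tree $T$ that is a subgraph of $G$ is a rainbow tree if no two edges of $T$ have the same color. For $S\subseteq V(G)$ with $|S|\geq 2$, a rainbow $S$-tree is a rainbow tree $T$ in $G$ with $S\subseteq V(T)$. For an integer $k$ with $2\leq k\leq n$, an edge-coloring of $G$ is a $k$-rainbow coloring if for every $k$-subset $S$ of $V(G)$ there exists a rainbow $S$-tree. The $k$-rainbow index $rx_k(G)$ is the minimum number of colors needed in a $k$-rainbow coloring of $G$. For integers $2\leq k\leq n$ and $\ell\geq 2$, $t(n,k,\ell)$ denotes the minimum size (number of edges) of a connected graph $G$ of order $n$ with $rx_k(G)\leq \ell$ (when such a graph exists). *)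

(* Defs.v *)
From mathcomp Require Import all_boot.

Set Implicit Arguments.
Unset Strict Implicit.
Unset Printing Implicit Defensive.

(* The vertex set is an explicit subset of the ambient type, so that subgraphs
   (in particular trees in a graph) are objects of the same type. *)
Record graph (V : finType) := Graph {
  vertices : {set V};
  edges : {set {set V}};
  edge_sub : forall e, e \in edges -> e \subset vertices;
  edge_card : forall e, e \in edges -> #|e| = 2 }.

Section Graphs.
Variable V : finType.
Implicit Types (G T : graph V) (S : {set V}) (c : {set V} -> nat).

Definition order G := #|vertices G|.
Definition num_edges G := #|edges G|.

Definition adj G : rel V := fun x y => [set x; y] \in edges G.

Definition connected G : Prop :=
  vertices G != set0 /\
  forall x y, x \in vertices G -> y \in vertices G -> connect (adj G) x y.

(* Every duplicate-free cyclic walk has at most two vertices: [:: x; y] with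
   [adj G x y] satisfies [cycle] but only goes back and forth along an edge. *)
Definition acyclic G : Prop :=
  forall s : seq V, cycle (adj G) s -> uniq s -> size s <= 2.

Definition is_tree T : Prop := connected T /\ acyclic T.

Definition subgraph T G : Prop :=
  vertices T \subset vertices G /\ edges T \subset edges G.

(* An edge-coloring of [G] is a function [c : {set V} -> nat], of which only
   the values on [edges G] matter. *)
Definition num_colors G c : nat := size (undup [seq c e | e in edges G]).

Definition rainbow T c : Prop := {in edges T &, injective c}.

Definition rainbow_Stree G c S T : Prop :=
  [/\ subgraph T G, is_tree T, rainbow T c & S \subset vertices T].

Definition rainbow_coloring k G c : Prop :=
  forall S, S \subset vertices G -> #|S| = k ->
  exists T, rainbow_Stree G c S T.

End Graphs.

Definition is_minimum (P : nat -> Prop) (m : nat) : Prop :=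
  P m /\ forall p, P p -> m <= p.

(* [rx k G r] means rx_k(G) = r. *)
Definition rx k (V : finType) (G : graph V) (r : nat) : Prop :=
  is_minimum
    (fun q => exists c, rainbow_coloring k G c /\ num_colors G c = q) r.

(* [t n k l m] means that t(n, k, l) is defined and equal to m. *)
Definition t (n k l m : nat) : Prop :=
  is_minimum
    (fun p => exists (V : finType) (G : graph V),
       [/\ order G = n, connected G,
           exists r, rx k G r /\ r <= l & num_edges G = p]) m.

(* Main.v *)
(* Write n = 1 + 3q + e with e <= 2. Join a hub [None] to every other vertex,
   and let the [inl] vertices form a cycle of length 3q (the rim), the [inr]
   ones remaining pendant. The spoke of the rim vertex i gets color i mod 3, the
   rim edge from i to i + 1 gets color 3 + (i mod 2), and the pendant spokes get
   the colors 3 and 4. Vertices with distinct spoke colors are joined by their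
   spokes. Otherwise some rim vertices reach the hub through a neighbor: the
   neighbors i + 1 and i - 1 offer the two other colors of {0, 1, 2}, through
   rim edges colored 3 and 4 (both are colored 3 at i = 0 when 3q is odd, which
   is why 0 has to be treated apart). If two vertices share a spoke color, the
   one which is not 0 has a detour avoiding the spoke color of the third. If all
   three share it, two of them have the same parity, and these detour in opposite
   directions. *)
Require Import Defs.
From mathcomp Require Import all_boot.
From mathcomp Require Import zify.
From Stdlib Require Import Classical.

Set Implicit Arguments.
Unset Strict Implicit.
Unset Printing Implicit Defensive.

(** * Minima of predicates, unordered pairs *)

(** Turns one example into an upper bound for [rx] and for [t]. Since [P] is not assumed decidable,
    the descent uses excluded middle. *)
Lemma is_minimum_exists (P : nat -> Prop) (p : nat) :
  P p -> exists m, is_minimum P m /\ m <= p.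
Proof.
elim/ltn_ind: p => p IH Pp.
have [[q [lt_qp Pq]]|noq] := classic (exists q, q < p /\ P q).
  have [m [minm le_mq]] := IH q lt_qp Pq.
  by exists m; split=> //; apply: leq_trans le_mq (ltnW lt_qp).
exists p; split=> //; split=> // q Pq.
by rewrite leqNgt; apply/negP=> lt_qp; apply: noq; exists q.
Qed.

Lemma eq_set2 (T : finType) (x y a b : T) :
  [set x; y] = [set a; b] -> (a = x /\ b = y) \/ (a = y /\ b = x).
Proof.
move=> E.
have: a \in [set x; y] by rewrite E set21.
have: b \in [set x; y] by rewrite E set22.
have: x \in [set a; b] by rewrite -E set21.
have: y \in [set a; b] by rewrite -E set22.
rewrite !in_set2 => /orP[]/eqP ? /orP[]/eqP ? /orP[]/eqP ? /orP[]/eqP ?;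
  subst; by [left|right].
Qed.

Lemma uniq_map_inj (aT rT : eqType) (f : aT -> rT) (s : seq aT) :
  uniq (map f s) -> {in s &, injective f}.
Proof.
elim: s => //= a s IH /andP[fas us] x y; rewrite !inE.
case/predU1P=> [->|xs] /predU1P[->|ys] // E; last exact: IH.
  by rewrite E map_f in fas.
by rewrite -E map_f in fas.
Qed.

(** * Connectedness and trees *)

Lemma adj_sym (V : finType) (G : graph V) : symmetric (adj G).
Proof. by move=> x y; rewrite /adj setUC. Qed.

Lemma connected_to_root (V : finType) (G : graph V) (r : V) :
  r \in vertices G ->
  {in vertices G, forall x, connect (adj G) x r} -> connected G.
Proof.
move=> rG conn; split; first by apply/set0Pn; exists r.
move=> x y xG yG; apply: connect_trans (conn _ xG) _.
by rewrite (sym_connect_sym (adj_sym G)) conn.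
Qed.

(** Following [p] strictly lowers [rank], so every path of parents ends at [r]. *)
Lemma parent_tree (V : finType) (r : V) (W : {set V}) (p : V -> V)
    (rank : V -> nat) :
  {in W, forall v, p v \in r |: W} -> {in W, forall v, rank (p v) < rank v} ->
  exists T : graph V, [/\ vertices T = r |: W,
    edges T = [set [set v; p v] | v in W] & is_tree T].
Proof.
move=> pW rankp.
have sub e : e \in [set [set v; p v] | v in W] -> e \subset r |: W.
  by case/imsetP=> v vW ->; rewrite subUset !sub1set pW // setU1r.
have card e : e \in [set [set v; p v] | v in W] -> #|e| = 2.
  case/imsetP=> v vW ->; rewrite cards2; case: eqP => // E.
  by have := rankp v vW; rewrite -E ltnn.
exists (Graph sub card); split=> //; split.
  apply: (@connected_to_root _ _ r); first exact: setU11.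
  move=> x /=; have [k] := ubnP (rank x); elim: k x => // k IH x ltk.
  rewrite in_setU1 => /predU1P[->|xW]; first exact: connect0.
  apply: connect_trans (IH (p x) _ (pW x xW)); last exact: leq_trans (rankp _ xW) _.
  by apply: connect1; apply/imsetP; exists x.
(* The vertex of largest rank on a cycle has both its neighbours equal to its
   parent. *)
have up x y : adj (Graph sub card) x y -> rank y <= rank x -> y = p x.
  case/imsetP=> v vW /eq_set2[[<- <-] //|[vy px]] le_yx.
  by have := rankp v vW; rewrite px vy ltnNge le_yx.
move=> s cs us; rewrite leqNgt; apply/negP=> s3.
have [x0 x0s] : exists x, x \in s by case: (s) s3 => // a l _; exists a; rewrite mem_head.
have [x xs maxx] := @arg_maxnP _ x0 (mem s) rank x0s.
have [i s' def_s] := rot_to xs.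
move: cs us s3; rewrite -(rot_cycle i) -(rot_uniq i) -(size_rot i) def_s.
case: s' def_s => [|y s'] // def_s /= /andP[xy].
have maxs z : z \in rot i s -> rank z <= rank x.
  by rewrite mem_rot => /maxx.
have -> : y = p x by apply: up xy (maxs _ _); rewrite def_s !inE eqxx orbT.
case/lastP: s' def_s => // s' z def_s.
rewrite rcons_path last_rcons => /andP[_]; rewrite adj_sym => xz.
have -> : z = p x.
  by apply: up xz (maxs _ _); rewrite def_s !inE mem_rcons mem_head !orbT.
by rewrite mem_rcons mem_head /= andbF.
Qed.

(** * The wheel with pendant edges and its coloring *)

Definition spoke_color (q e : nat) (u : 'I_(3 * q) + 'I_e) : nat :=
  match u with inl i => i %% 3 | inr j => 3 + j end.

(** The inner [if] finds the tail of a rim edge, the endpoint whose successor is the other one. The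
    final 0 is a filler for pairs that are not edges. *)
Definition pair_color (q e : nat) (x y : option ('I_(3 * q) + 'I_e)) : nat :=
  match x, y with
  | None, Some u | Some u, None => spoke_color u
  | Some (inl i), Some (inl j) => 3 + odd (if j == ordS i then i else j)
  | _, _ => 0
  end.

Definition color (q e : nat) (s : {set option ('I_(3 * q) + 'I_e)}) : nat :=
  if [pick xy | s == [set xy.1; xy.2]] is Some xy then pair_color xy.1 xy.2
  else 0.

Lemma color_pair (q e : nat) (x y : option ('I_(3 * q) + 'I_e)) :
  pair_color x y = pair_color y x -> color [set x; y] = pair_color x y.
Proof.
move=> sym; rewrite /color; case: pickP => [[a b] /eqP /=|/(_ (x, y))]; last first.
  by rewrite eqxx.
by case/eq_set2 => -[-> ->].
Qed.

Lemma val_ordS (m : nat) (i : 'I_m) : ordS i = i.+1 %% m :> nat.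
Proof. by []. Qed.

Lemma ordS_cases (m : nat) (i : 'I_m) :
  (ordS i = i.+1 :> nat /\ i.+1 < m) \/ (ordS i = 0 :> nat /\ i.+1 = m).
Proof.
rewrite val_ordS; have := ltn_ord i; rewrite leq_eqVlt => /predU1P[->|lt_im].
  by right; rewrite modnn.
by left; rewrite modn_small.
Qed.

Lemma ordS_neq (q : nat) (i : 'I_(3 * q)) : ordS i != i.
Proof. by apply/eqP=> /(congr1 val) /=; have := ordS_cases i; lia. Qed.

(** A nonempty rim has length at least 3, so the tail of a rim edge is unambiguous. *)
Lemma ordSS_neq (q : nat) (i : 'I_(3 * q)) : ordS (ordS i) != i.
Proof.
apply/eqP=> /(congr1 val) /=.
by have := ordS_cases i; have := ordS_cases (ordS i); lia.
Qed.

Definition wheel_edges (q e : nat) : {set {set option ('I_(3 * q) + 'I_e)}} :=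
  [set [set Some u; None] | u : 'I_(3 * q) + 'I_e] :|:
  [set [set Some (inl i); Some (inl (ordS i))] | i : 'I_(3 * q)].

Lemma wheel_edge_sub (q e : nat) (s : {set option ('I_(3 * q) + 'I_e)}) :
  s \in wheel_edges q e -> s \subset [set: option ('I_(3 * q) + 'I_e)].
Proof. by move=> _; apply: subsetT. Qed.

Lemma wheel_edge_card (q e : nat) (s : {set option ('I_(3 * q) + 'I_e)}) :
  s \in wheel_edges q e -> #|s| = 2.
Proof.
case/setUP=> /imsetP[u _ ->]; rewrite cards2 //.
by case: eqP => // -[/esym/eqP]; rewrite (negPf (ordS_neq u)).
Qed.

Definition wheel (q e : nat) : graph (option ('I_(3 * q) + 'I_e)) :=
  Graph (@wheel_edge_sub q e) (@wheel_edge_card q e).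

Lemma order_wheel (q e : nat) : Defs.order (wheel q e) = (3 * q + e).+1.
Proof. by rewrite /Defs.order cardsT card_option card_sum !card_ord. Qed.

Lemma num_edges_wheel (q e : nat) : num_edges (wheel q e) <= 2 * (3 * q) + e.
Proof.
rewrite /num_edges /= /wheel_edges (leq_trans (leq_card_setU _ _)) //.
rewrite mul2n -addnn addnAC leq_add //.
  by rewrite (leq_trans (leq_imset_card _ _)) // card_sum !card_ord.
by rewrite (leq_trans (leq_imset_card _ _)) // card_ord.
Qed.

Lemma spoke_edge (q e : nat) (u : 'I_(3 * q) + 'I_e) :
  [set Some u; None] \in edges (wheel q e).
Proof. by apply/setUP; left; apply: imset_f. Qed.

Lemma color_spoke (q e : nat) (u : 'I_(3 * q) + 'I_e) :
  color [set Some u; None] = spoke_color u.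
Proof. by rewrite color_pair //; case: u. Qed.

Lemma color_rim (q e : nat) (i : 'I_(3 * q)) :
  color [set Some (inl i); Some (inl (ordS i) : 'I_(3 * q) + 'I_e)] = 3 + odd i.
Proof. by rewrite color_pair /= ?eqxx // eq_sym (negPf (ordSS_neq i)). Qed.

Lemma connected_wheel (q e : nat) : connected (wheel q e).
Proof.
apply: (@connected_to_root _ _ None); first exact: in_setT.
by move=> [u|] _; rewrite ?connect0 // connect1 // /adj spoke_edge.
Qed.

Lemma num_colors_wheel (q e : nat) : e <= 2 -> num_colors (wheel q e) (@color q e) <= 5.
Proof.
move=> e2; rewrite -(size_iota 0 5); apply: uniq_leq_size; first exact: undup_uniq.
move=> k; rewrite mem_undup => /mapP[s]; rewrite mem_enum => + ->.
rewrite mem_iota; case/setUP=> /imsetP[u _ ->].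
  rewrite color_spoke; case: u => [i|j] /=; last by have := ltn_ord j; lia.
  by have := ltn_pmod i (isT : 0 < 3); lia.
by rewrite color_rim; case: odd.
Qed.

(* [b] tells whether the neighbor is i + 1 or i - 1. *)
Lemma detour (q e : nat) (i : 'I_(3 * q)) (b : bool) : b || (i != 0 :> nat) ->
  exists w : 'I_(3 * q) + 'I_e,
    [/\ [set Some (inl i); Some w] \in edges (wheel q e),
        color [set Some (inl i); Some w] = 3 + (odd i == b) &
        spoke_color w = (i %% 3 + 2 - b) %% 3].
Proof.
case: b => /= [_|i0].
  exists (inl (ordS i)); split.
  - by apply/setUP; right; apply: imset_f.
  - by rewrite color_rim; case: odd.
  (* Residues mod 3 survive the wrap-around because 3 divides [3 * q]. *)
  - by rewrite /= modn_dvdm ?dvdn_mulr // -addnBA // modnDml addn1.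
(* As [i] is not 0, its predecessor is [i.-1], of opposite parity. *)
have lt_i := ltn_ord i.
have lt_j : i.-1 < 3 * q by lia.
have Sj : ordS (Ordinal lt_j) = i.
  by apply: val_inj; rewrite /= prednK ?modn_small //; lia.
exists (inl (Ordinal lt_j)); split.
- by apply/setUP; right; apply/imsetP; exists (Ordinal lt_j); rewrite // Sj setUC.
- have := @color_rim q e (Ordinal lt_j); rewrite Sj setUC => -> /=; congr (3 + _).
  by case: (nat_of_ord i) i0 => //= k _; case: odd.
- rewrite /= subn0 modnDml -modnDr; congr (_ %% _); lia.
Qed.

(** * Rainbow trees made of short routes to the hub *)

(** [g u] is the next vertex on the route from [u] to the hub [None]. Routes have length at most 2,
    and the tree has one edge per vertex of [X]. *)
Lemma routes_tree (q e : nat) (X : seq ('I_(3 * q) + 'I_e))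
    (g : 'I_(3 * q) + 'I_e -> option ('I_(3 * q) + 'I_e))
    (S : {set option ('I_(3 * q) + 'I_e)}) :
  (forall u w, u \in X -> g u = Some w ->
     [/\ w \in X, g w = None & [set Some u; Some w] \in edges (wheel q e)]) ->
  uniq [seq color [set Some u; g u] | u <- X] ->
  (forall u, Some u \in S -> u \in X) ->
  exists T, rainbow_Stree (wheel q e) (@color q e) S T.
Proof.
move=> gX uX SX.
pose W := [set Some u | u in X].
pose rank v := if v is Some u then 1 + (g u != None) else 0.
have [|_ /imsetP[u uX' ->] |T [vT eT tT]] := @parent_tree _ None W (obind g) rank.
- move=> _ /imsetP[u uX' ->] /=; case gu: (g u) => [w|]; last exact: setU11.
  by have [wX _ _] := gX _ _ uX' gu; rewrite setU1r //; apply: imset_f.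
- rewrite /=; case gu: (g u) => [w|] //=.
  by have [_ -> _] := gX _ _ uX' gu.
exists T; split=> //.
- split; first exact: subsetT.
  rewrite eT; apply/subsetP=> _ /imsetP[_ /imsetP[u uX' ->] ->] /=.
  case gu: (g u) => [w|]; last exact: spoke_edge.
  by have [_ _] := gX _ _ uX' gu.
- rewrite /rainbow eT => _ _ /imsetP[_ /imsetP[u uX1 ->] ->]
    /imsetP[_ /imsetP[v vX ->] ->] /=.
  by move/(uniq_map_inj uX uX1 vX) ->.
- rewrite vT; apply/subsetP=> -[u|] uS; last exact: setU11.
  by rewrite setU1r // imset_f ?SX.
Qed.

Lemma one_detour (q e : nat) (S : {set option ('I_(3 * q) + 'I_e)})
    (v : 'I_(3 * q) + 'I_e) (i : 'I_(3 * q)) (us : seq ('I_(3 * q) + 'I_e)) :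
  v != inl i -> spoke_color v = i %% 3 -> i != 0 :> nat -> size us <= 1 ->
  {in us, forall u, spoke_color u != i %% 3} ->
  (forall u, Some u \in S -> u \in [:: v, inl i & us]) ->
  exists T, rainbow_Stree (wheel q e) (@color q e) S T.
Proof.
move=> vi vE i0 us1 usE SX.
(* 5 is not the color of any edge. *)
pose c := if us is u :: _ then spoke_color u else 5.
(* The detour goes to the successor unless [c] is the color of the rim edge leading there or of the
   spoke after it. In both of these cases [c] differs from the two colors used through the
   predecessor. *)
have [b bE] : exists b : bool, b = (c != 3 + odd i) && (c != (i %% 3 + 1) %% 3).
  by eexists.
have [|w [wE wc ws]] := @detour q e i b; first by rewrite i0 orbT.
have wi : w != inl i.
  by apply/eqP=> E; move: ws; rewrite E /=;
    case: (i %% 3) (ltn_pmod i (isT : 0 < 3)) => [|[|[|]]] //; case: (b).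
have usi u : u \in us -> u != inl i.
  by move/usE; apply: contraNneq => ->.
apply: (@routes_tree _ _ [:: v, inl i, w & us]
  (fun u => if u == inl i then Some w else None)).
- move=> u w' _; case: eqP => // -> [<-].
  by split; rewrite /= ?(negPf wi) // !inE eqxx !orbT.
- rewrite /= eqxx (negPf wi) (negPf vi) !color_spoke wc ws vE.
  case: us us1 usE usi @c {SX} bE => [|u [|//]] _ usE usi c bE /=.
    rewrite !inE; case: (i %% 3) (ltn_pmod i (isT : 0 < 3)) => [|[|[|]]] // _;
    by case: (b); case: odd.
  have := usE _ (mem_head _ _); move: bE; rewrite /c.
  rewrite (negPf (usi _ (mem_head _ _))) color_spoke !inE.
  case: (i %% 3) (ltn_pmod i (isT : 0 < 3)) => [|[|[|]]] // _;
    by case: b {wc ws}; case: odd; lia.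
- by move=> u /SX; rewrite !inE => /or3P[]->; rewrite ?orbT.
Qed.

Lemma two_detours (q e : nat) (S : {set option ('I_(3 * q) + 'I_e)})
    (i j k : 'I_(3 * q)) :
  uniq [:: i; j; k] -> i = j %[mod 3] -> i = k %[mod 3] -> odd j = odd k ->
  (forall u, Some u \in S -> u \in [:: inl i; inl j; inl k]) ->
  exists T, rainbow_Stree (wheel q e) (@color q e) S T.
Proof.
(* At most one of [j] and [k] is 0, and their roles can be exchanged. *)
wlog k0 : j k / k != 0 :> nat.
  move=> IH ijk Ej Ek jk SX; have [k0|] := eqVneq (nat_of_ord k) 0; last first.
    by move=> k0; apply: (IH j k).
  apply: (IH k j) => //; last by move=> u /SX; rewrite !inE => /or3P[]->; rewrite ?orbT.
    by apply: contraTneq ijk => j0; rewrite /= !inE -[j == k]val_eqE /= k0 j0 andbF.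
  by move: ijk; rewrite /= !inE !negb_or (eq_sym k) -!andbA andbCA.
move=> ijk Ej Ek jk SX.
(* With these directions the rim edge at [j] gets color 3 and the one at [k] gets color 4. The
   vertex 0 is even, so [j = 0] would only use its successor. *)
have [|v [vE vc vs]] := @detour q e j (~~ odd j).
  by case: (nat_of_ord j) => //= ?; rewrite orbT.
have [|w [wE wc ws]] := @detour q e k (odd k); first by rewrite k0 orbT.
have vspoke (l : 'I_(3 * q)) : i = l %[mod 3] -> v != inl l.
  by move=> El; apply/eqP=> E; move: vs; rewrite E /= -El -Ej;
    case: (i %% 3) (ltn_pmod i (isT : 0 < 3)) => [|[|[|]]] //; case: odd.
have wspoke (l : 'I_(3 * q)) : i = l %[mod 3] -> w != inl l.
  by move=> El; apply/eqP=> E; move: ws; rewrite E /= -El -Ek;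
    case: (i %% 3) (ltn_pmod i (isT : 0 < 3)) => [|[|[|]]] //; case: odd.
have [ij ik jk'] : [/\ inl i != inl j :> 'I_(3 * q) + 'I_e,
    inl i != inl k :> 'I_(3 * q) + 'I_e & inl k != inl j :> 'I_(3 * q) + 'I_e].
  by move: ijk; rewrite /= !inE negb_or (eq_sym j) andbT => /andP[/andP[]].
pose g (u : 'I_(3 * q) + 'I_e) :=
  if u == inl j then Some v else if u == inl k then Some w else None.
have gi : g (inl i) = None by rewrite /g (negPf ij) (negPf ik).
have gj : g (inl j) = Some v by rewrite /g eqxx.
have gv : g v = None by rewrite /g (negPf (vspoke _ Ej)) (negPf (vspoke _ Ek)).
have gk : g (inl k) = Some w by rewrite /g eqxx (negPf jk').
have gw : g w = None by rewrite /g (negPf (wspoke _ Ej)) (negPf (wspoke _ Ek)).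
apply: (@routes_tree _ _ [:: inl i; inl j; v; inl k; w] g).
- move=> u x; rewrite !in_cons in_nil orbF => /or4P[||| /orP[]] /eqP->;
    rewrite ?gi ?gj ?gv ?gk ?gw // => -[<-]; split=> //;
    by rewrite eqxx !orbT.
- rewrite /= gi gj gv gk gw !color_spoke vc wc vs ws -Ej -Ek !inE /= jk.
  case: (i %% 3) (ltn_pmod i (isT : 0 < 3)) => [|[|[|]]] // _;
    by case: (odd k).
- by move=> u /SX; rewrite !inE => /or3P[]->; rewrite ?orbT.
Qed.

(** * Case analysis on the spoke colors of a triple *)

(** Rim spokes have colors below 3; pendant spokes have distinct colors from 3 on. *)
Lemma eq_spoke_color (q e : nat) (u v : 'I_(3 * q) + 'I_e) :
  u != v -> spoke_color u = spoke_color v ->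
  exists i j, [/\ u = inl i, v = inl j, i != j & i = j %[mod 3]].
Proof.
case: u v => [i|i] [j|j] /=; [|lia|lia|]; first by move=> ij E; exists i, j.
by move=> /eqP ij [E]; case: ij; congr inr; apply: val_inj.
Qed.

Lemma wheel_rainbow (q e : nat) : rainbow_coloring 3 (wheel q e) (@color q e).
Proof.
(* The hub lies in every tree built here, so only the other vertices of [S] matter. *)
move=> S _ S3; pose D := [set u | Some u \in S].
have D3 : #|D| <= 3.
  rewrite -[leqRHS]S3 -(card_imset D (@Some_inj _)); apply: subset_leq_card.
  by apply/subsetP=> _ /imsetP[u + ->]; rewrite inE.
have [/(dinjectiveP _ _) inj|] := boolP (dinjectiveb (@spoke_color q e) (mem D)).
  apply: (@routes_tree _ _ (enum D) (fun=> None)) => //.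
    rewrite (eq_map (@color_spoke q e)) map_inj_in_uniq ?enum_uniq //.
    by move=> u v; rewrite !mem_enum; apply: inj.
  by move=> u uS; rewrite mem_enum inE.
case/dinjectivePn=> u uD [v /andP[/= vu vD] E]; rewrite /= in uD.
have {}vD : v \in D := vD.
have [i [j [iu jv ij Eij]]] := eq_spoke_color (contra_neq (@esym _ _ _) vu) E.
pose us := enum (D :\ u :\ v).
have us1 : size us <= 1.
  rewrite -cardE; move: D3.
  by rewrite (cardsD1 u) uD (cardsD1 v (D :\ u)) in_setD1 vu vD.
have uvS x : Some x \in S -> x \in [:: u, v & us].
  by rewrite !inE mem_enum !inE => ->; case: eqP => //; case: eqP.
(* If [S] contains the hub, [us] is empty and this case applies. *)
have [usE|] := boolP (all (fun x => spoke_color x != i %% 3) us).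
  have [j0|j0] := eqVneq (nat_of_ord j) 0; last first.
    apply: (@one_detour q e S u j us) => //.
    - by rewrite -jv eq_sym.
    - by rewrite iu.
    - by rewrite -Eij; apply/allP.
    - by rewrite -jv.
  apply: (@one_detour q e S v i us) => //.
  - by rewrite -iu.
  - by rewrite jv.
  - by apply: contra_neq ij => i0; apply: val_inj; rewrite /= i0 j0.
  - by apply/allP.
  - by move=> x /uvS; rewrite !inE iu => /or3P[]->; rewrite ?orbT.
case/allPn=> x xus; rewrite negbK => /eqP xE.
have usx : us = [:: x].
  by case: (us) us1 xus => [|y [|//]] // _; rewrite inE => /eqP->.
move: xus; rewrite mem_enum !inE => /and3P[xv xu _].
have [_ [k [[<-] xk ik Eik]]] : exists i' k, [/\ inl i = inl i' :> 'I_(3 * q) + 'I_e,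
    x = inl k, i' != k & i' = k %[mod 3]].
  by apply: eq_spoke_color; rewrite ?xE // -iu eq_sym.
rewrite usx iu jv xk in uvS xv.
have jk : j != k by apply: contraNneq xv => ->.
(* Two of the three parities agree; the remaining vertex is passed first and keeps its spoke. *)
have [ijp|ijp] := eqVneq (odd i) (odd j).
  apply: (@two_detours q e S k i j) => //.
  - by rewrite /= !inE negb_or !(eq_sym k) ik jk ij.
  - by rewrite -Eik.
  - by move=> y /uvS; rewrite !inE => /or3P[]->; rewrite ?orbT.
have [jkp|jkp] := eqVneq (odd j) (odd k).
  by apply: (@two_detours q e S i j k) => //; rewrite /= !inE negb_or ij ik jk.
apply: (@two_detours q e S j i k) => //.
- by rewrite /= !inE negb_or (eq_sym j) ij ik jk.
- by rewrite -Eij.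
- by case: (odd i) (odd j) (odd k) ijp jkp => [] [] [].
- by move=> y /uvS; rewrite !inE => /or3P[]->; rewrite ?orbT.
Qed.

Theorem proposition2p9 (n : nat) (hn : 3 <= n) :
  exists m : nat, t n 3 5 m /\ m <= 2 * n - 2.
Proof.
pose q := n.-1 %/ 3; pose e := n.-1 %% 3.
have e2 : e <= 2 by rewrite -ltnS ltn_pmod.
have nE : n.-1 = 3 * q + e by rewrite mulnC -divn_eq.
have [r [rxr le_r]] := is_minimum_exists
  (ex_intro _ _ (conj (@wheel_rainbow q e) erefl) :
    (fun p => exists c, rainbow_coloring 3 (wheel q e) c /\
                        num_colors (wheel q e) c = p) _).
have [|m [tm le_m]] := @is_minimum_exists (fun p => exists (V : finType) (G : graph V),
    [/\ Defs.order G = n, connected G, exists r, rx 3 G r /\ r <= 5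
      & num_edges G = p]) (num_edges (wheel q e)).
  exists _, (wheel q e); split=> //.
  - by rewrite order_wheel -nE prednK // (leq_trans _ hn).
  - exact: connected_wheel.
  - by exists r; split=> //; apply: leq_trans le_r (num_colors_wheel q e2).
exists m; split=> //; apply: leq_trans le_m (leq_trans (num_edges_wheel q e) _).
(* The edge bound [6q + e] equals [2(n - 1) - e]. *)
by lia.
Qed.
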